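(* Let $L,C,\omega>0$ be constants, and let $H:\mathbb{R}^5\to\mathbb{R}$, the matrices $J\in\mathbb{R}^{5\times5}$, $B\in\mathbb{R}^{5\times2}$ and the matrix function $C(\mathbf{x})\in\mathbb{R}^{5\times2}$ be those of the grid-forming SVG system given in the context. For step size $h>0$, consider the midpoint rule $$\frac{\mathbf{x}_{k+1}-\mathbf{x}_k}{h}=J\nabla H\Big(\frac{\mathbf{x}_{k+1}+\mathbf{x}_k}{2}\Big)+B\mathbf{d}_k+C\Big(\frac{\mathbf{x}_{k+1}+\mathbf{x}_k}{2}\Big)\mathbf{u}_k .$$ Then the midpoint rule is Dirac-structure-preserving with $\overline{\nabla H}(\mathbf{x}_k,\mathbf{x}_{k+1})=\nabla H\big(\frac{\mathbf{x}_k+\mathbf{x}_{k+1}}2\big)$, $B_{k,k+1}=B$ and $C_{k,k+1}=C\big(\frac{\mathbf{x}_k+\mathbf{x}_{k+1}}2\big)$; that is, $H(\mathbf{x}_{k+1})-H(\mathbf{x}_k)=\nabla H\big(\frac{\mathbf{x}_{k+1}+\mathbf{x}_k}2\big)^\top(\mathbf{x}_{k+1}-\mathbf{x}_k)$ and, for all $\mathbf{u}_k,\mathbf{d}_k\in\mathbb{R}^2$ and all $\mathbf{x}_k,\mathbf{x}_{k+1}\in\mathbb{R}^5$ related by the midpoint rule, $$\nabla H\Big(\frac{\mathbf{x}_{k+1}+\mathbf{x}_k}2\Big)^\top(\mathbf{x}_{k+1}-\mathbf{x}_k)=h\,\nabla H\Big(\frac{\mathbf{x}_{k+1}+\mathbf{x}_k}2\Big)^\top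 B\mathbf{d}_k,$$ where $C_{k,k+1}^\top\,\nabla H\big(\frac{\mathbf{x}_{k+1}+\mathbf{x}_k}2\big)=\mathbf{0}$. In particular, it exactly conserves the Hamiltonian energy when the disturbance is absent: if $\mathbf{d}_k=\mathbf{0}$ then $H(\mathbf{x}_{k+1})=H(\mathbf{x}_k)$ for every $\mathbf{u}_k\in\mathbb{R}^2$.
   Context: The grid-forming SVG system is $\dot{\mathbf{x}}=J\nabla H(\mathbf{x})+B\mathbf{d}+C(\mathbf{x})\mathbf{u}$ on $\mathbb{R}^5$ with $$H(\mathbf{x})=\frac L2(x_1^2+x_2^2)+\frac C2(x_3^2+x_4^2)+x_5,$$ $$J=\begin{bmatrix}0&\frac{\omega}{L}&-\frac1{CL}&0&0\\-\frac{\omega}{L}&0&0&-\frac1{CL}&0\\\frac1{CL}&0&0&\frac{\omega}{C}&0\\0&\frac1{CL}&-\frac{\omega}{C}&0&0\\0&0&0&0&0\end{bmatrix},\quad B=\begin{bmatrix}0&0\\0&0\\\frac1C&0\\0&\frac1C\\0&0\end{bmatrix},\quad C(\mathbf{x})=\begin{bmatrix}\frac1L&0\\0&\frac1L\\0&0\\0&0\\-x_1&-x_2\end{bmatrix}.$$ (The scalar constant $C$ is the capacitance; the matrix function $C(\mathbf{x})$ is always written with its argument.) Definition: for a port-Hamiltonian system $\dot{\mathbf{x}}=J(\mathbf{x})\nabla H(\mathbf{x})+B(\mathbf{x})\mathbf{d}+C(\mathbf{x})\mathbf{u}$, suppose $\overline{\nabla H}:\mathbb{R}^n\times\mathbb{R}^n\to\mathbb{R}^n$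 satisfies $H(\mathbf{x}_{k+1})-H(\mathbf{x}_k)=\overline{\nabla H}(\mathbf{x}_k,\mathbf{x}_{k+1})^\top(\mathbf{x}_{k+1}-\mathbf{x}_k)$. A one-step algorithm $\mathbf{x}_k\mapsto\mathbf{x}_{k+1}$ is Dirac-structure-preserving if $$\overline{\nabla H}(\mathbf{x}_k,\mathbf{x}_{k+1})^\top(\mathbf{x}_{k+1}-\mathbf{x}_k)=h\,\overline{\nabla H}(\mathbf{x}_k,\mathbf{x}_{k+1})^\top\big(C_{k,k+1}\mathbf{u}_k+B_{k,k+1}\mathbf{d}_k\big)$$ for all inputs $\mathbf{u}_k$ and disturbances $\mathbf{d}_k$, where $C_{k,k+1},B_{k,k+1}$ are matrices approximating $C(\mathbf{x}),B(\mathbf{x})$ over the step, and where, if $C(\mathbf{x})^\top\nabla H(\mathbf{x})=\mathbf{0}$ identically (as holds for the SVG system), one requires $C_{k,k+1}^\top\overline{\nabla H}(\mathbf{x}_k,\mathbf{x}_{k+1})=\mathbf{0}$. *)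

(* Defs.v *)
From HB Require Import structures.
From mathcomp Require Import all_boot all_order all_algebra.
From mathcomp Require Import all_classical all_reals all_analysis.
Import Order.TTheory GRing.Theory Num.Theory.
Import numFieldNormedType.Exports.

Set Implicit Arguments.
Unset Strict Implicit.
Unset Printing Implicit Defensive.

Local Open Scope classical_set_scope.
Local Open Scope ring_scope.

Section PortHamiltonian.
Context {R : realType}.

Definition dotv n (u v : 'cV[R]_n) : R := (u^T *m v) 0 0.

Definition grad n (f : 'cV[R]_n -> R) (x : 'cV[R]_n) : 'cV[R]_n :=
  \col_i 'D_(delta_mx i 0) f x.

Definition midpoint n (x y : 'cV[R]_n) : 'cV[R]_n := 2^-1 *: (x + y).

(* dx/dt = J(x) grad H(x) + B(x) d + C(x) u, with state in R^n,
   disturbance d in R^p and input u in R^m. *)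
Record ph_system (n p m : nat) := PHSystem {
  ph_H : 'cV[R]_n -> R;
  ph_J : 'cV[R]_n -> 'M[R]_n;
  ph_B : 'cV[R]_n -> 'M[R]_(n, p);
  ph_C : 'cV[R]_n -> 'M[R]_(n, m) }.

(* [step d u x y]: y is an admissible next state from x; a relation because
   the algorithm may be implicit. *)
Definition one_step_algorithm (n p m : nat) :=
  'cV[R]_p -> 'cV[R]_m -> 'cV[R]_n -> 'cV[R]_n -> Prop.

Definition discrete_gradient n (H : 'cV[R]_n -> R)
    (gH : 'cV[R]_n -> 'cV[R]_n -> 'cV[R]_n) : Prop :=
  forall x y, H y - H x = dotv (gH x y) (y - x).

(* [M' x y] approximates [M] over a step from x to y: it tends to [M x0] when
   both end points tend to x0. *)
Definition approximates n q (M : 'cV[R]_n -> 'M[R]_(n, q))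
    (M' : 'cV[R]_n -> 'cV[R]_n -> 'M[R]_(n, q)) : Prop :=
  forall x0, M' z.1 z.2 @[z --> (x0, x0)] --> M x0.

Definition dirac_structure_preserving n p m (S : ph_system n p m) (h : R)
    (gH : 'cV[R]_n -> 'cV[R]_n -> 'cV[R]_n)
    (B' : 'cV[R]_n -> 'cV[R]_n -> 'M[R]_(n, p))
    (C' : 'cV[R]_n -> 'cV[R]_n -> 'M[R]_(n, m))
    (step : one_step_algorithm n p m) : Prop :=
  [/\ discrete_gradient (ph_H S) gH,
      approximates (ph_B S) B',
      approximates (ph_C S) C',
      forall d u x y, step d u x y ->
        dotv (gH x y) (y - x) = h * dotv (gH x y) (C' x y *m u + B' x y *m d)
    & (forall x, (ph_C S x)^T *m grad (ph_H S) x = 0) ->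
        forall x y, (C' x y)^T *m gH x y = 0].

End PortHamiltonian.

Section SVG.
Context {R : realType}.

(* Zero-based indices: [x i 0] is the (i+1)-st component of x. *)
Definition svg_H (L C : R) (x : 'cV[R]_5) : R :=
  L / 2 * (x 0 0 ^+ 2 + x 1 0 ^+ 2) + C / 2 * (x 2 0 ^+ 2 + x 3 0 ^+ 2) + x 4 0.

Definition mx_of_rows m n (s : seq (seq R)) : 'M[R]_(m, n) :=
  \matrix_(i, j) nth 0 (nth [::] s i) j.

Definition svg_J (L C omega : R) : 'M[R]_5 := mx_of_rows 5 5
  [:: [:: 0;              omega / L;      - (C * L)^-1;   0;              0];
      [:: - (omega / L);  0;              0;              - (C * L)^-1;   0];
      [:: (C * L)^-1;     0;              0;              omega / C;      0];
      [:: 0;              (C * L)^-1;     - (omega / C);  0;              0];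
      [:: 0;              0;              0;              0;              0]].

Definition svg_B (C : R) : 'M[R]_(5, 2) := mx_of_rows 5 2
  [:: [:: 0;    0   ];
      [:: 0;    0   ];
      [:: C^-1; 0   ];
      [:: 0;    C^-1];
      [:: 0;    0   ]].

Definition svg_C (L : R) (x : 'cV[R]_5) : 'M[R]_(5, 2) := mx_of_rows 5 2
  [:: [:: L^-1;      0         ];
      [:: 0;         L^-1      ];
      [:: 0;         0         ];
      [:: 0;         0         ];
      [:: - x 0 0;   - x 1 0   ]].

Definition svg_system (L C omega : R) : ph_system 5 2 2 :=
  PHSystem (svg_H L C) (fun=> svg_J L C omega) (fun=> svg_B C) (svg_C L).

Definition svg_midpoint_rule (L C omega h : R) : one_step_algorithm 5 2 2 :=
  fun d u x y =>
    h^-1 *: (y - x) =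
      svg_J L C omega *m grad (svg_H L C) (midpoint x y)
      + svg_B C *m d + svg_C L (midpoint x y) *m u.

End SVG.

(* Main.v *)
(** [H] is a polynomial of degree 2, so its increment over a step is exactly its
    gradient at the midpoint paired with the increment of the state. Substituting
    the midpoint rule, the [J] term drops out because [J] is skew-symmetric, and
    the input term because [C(x)^T grad H(x) = 0] at every state, in particular
    at the midpoint; only the disturbance term is left. *)
Require Import Defs.
From HB Require Import structures.
From mathcomp Require Import all_boot all_order all_algebra.
From mathcomp Require Import all_classical all_reals all_analysis.
From mathcomp Require Import ring.
Import Order.TTheory GRing.Theory Num.Theory.
Import numFieldNormedType.Exports.
Local Open Scope ring_scope.

Lemma big_ord5 (V : nmodType) (F : 'I_5 -> V) :
  \sum_(i < 5) F i = F 0 + F 1 + F 2 + F 3 + F 4.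
Proof.
rewrite !big_ord_recr big_ord0 /= add0r.
by congr (F _ + F _ + F _ + F _ + F _); apply: val_inj.
Qed.

Lemma ord5_ind (P : 'I_5 -> Prop) : P 0 -> P 1 -> P 2 -> P 3 -> P 4 -> forall i, P i.
Proof.
move=> P0 P1 P2 P3 P4 [[|[|[|[|[|//]]]]] ilt].
- by rewrite (_ : Ordinal ilt = 0)//; apply: val_inj.
- by rewrite (_ : Ordinal ilt = 1)//; apply: val_inj.
- by rewrite (_ : Ordinal ilt = 2)//; apply: val_inj.
- by rewrite (_ : Ordinal ilt = 3)//; apply: val_inj.
- by rewrite (_ : Ordinal ilt = 4)//; apply: val_inj.
Qed.

Lemma dotvDr (R : realType) n (u v w : 'cV[R]_n) :
  dotv u (v + w) = dotv u v + dotv u w.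
Proof. by rewrite /dotv mulmxDr mxE. Qed.

Lemma dotvZr (R : realType) n a (u v : 'cV[R]_n) :
  dotv u (a *: v) = a * dotv u v.
Proof. by rewrite /dotv -scalemxAr mxE. Qed.

(** A scalar is its own transpose, and transposing [v^T J v] replaces [J] by [J^T = - J]; the value
    is therefore its own opposite. *)
Lemma dotv_skew (R : realType) n (J : 'M[R]_n) (v : 'cV[R]_n) :
  J^T = - J -> dotv v (J *m v) = 0.
Proof.
move=> Jskew; have vJv : dotv v (J *m v) = - dotv v (J *m v).
  have trE (A : 'M[R]_1) : A 0 0 = A^T 0 0 by rewrite mxE.
  rewrite {1}/dotv trE !trmx_mul trmxK Jskew mulmxN mulNmx mxE.
  by rewrite /dotv mulmxA.
by apply/eqP; rewrite -eqNr -vJv.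
Qed.

(** For [t != 0] the difference quotient along [v] is exactly [a + t * b], which tends to [a].
    Partial derivatives of a quadratic function can thus be read off its expansion in [t]. *)
Lemma derive_quadratic (R : realType) (V : normedModType R) (f : V -> R)
    (x v : V) (a b : R) :
  (forall t, f (t *: v + x) = f x + t * a + t ^+ 2 * b) -> 'D_v f x = a.
Proof.
move=> fE; apply: cvg_lim => //.
have lim : ((fun t : R => a + t * b) @ 0^' --> a + 0 * b)%classic.
  apply: cvgD; [exact: cvg_cst|apply: cvgMr_tmp; exact: nbhs_dnbhs].
rewrite mul0r addr0 in lim; apply: cvg_trans lim; apply: near_eq_cvg; near=> t.
have t0 : t != 0 by near: t; exact: nbhs_dnbhs_neq.
rewrite /= fE.
by rewrite -[LHS](mulKf t0) /GRing.scale/=; congr (_ * _); ring.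
Unshelve. all: by end_near. Qed.

Definition svg_gradient {R : realType} (L C : R) (x : 'cV[R]_5) : 'cV[R]_5 :=
  mx_of_rows 5 1
    [:: [:: L * x 0 0]; [:: L * x 1 0]; [:: C * x 2 0]; [:: C * x 3 0]; [:: 1]].

Lemma grad_svg_H (R : realType) (L C : R) (x : 'cV[R]_5) :
  grad (svg_H L C) x = svg_gradient L C x.
Proof.
apply/matrixP => i j; rewrite (ord1 j) !mxE; move: i; apply: ord5_ind => /=.
(* The explicit argument is the coefficient of [t ^+ 2] in [svg_H] along the basis vector: [L / 2]
   or [C / 2] for the quadratic coordinates, [0] for the last one, in which [svg_H] is affine. *)
- by apply: (@derive_quadratic _ _ _ _ _ _ (L / 2)) => t;
    rewrite /svg_H !mxE/=; field.
- by apply: (@derive_quadratic _ _ _ _ _ _ (L / 2)) => t;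
    rewrite /svg_H !mxE/=; field.
- by apply: (@derive_quadratic _ _ _ _ _ _ (C / 2)) => t;
    rewrite /svg_H !mxE/=; field.
- by apply: (@derive_quadratic _ _ _ _ _ _ (C / 2)) => t;
    rewrite /svg_H !mxE/=; field.
- by apply: (@derive_quadratic _ _ _ _ _ _ 0) => t;
    rewrite /svg_H !mxE/=; field.
Qed.

Lemma svg_J_skew (R : realType) (L C omega : R) :
  (svg_J L C omega)^T = - svg_J L C omega.
Proof.
apply/matrixP => i j; rewrite !mxE; move: i j.
by apply: ord5_ind; apply: ord5_ind; rewrite /= ?oppr0 ?opprK.
Qed.

(** Each square contributes through [b^2 - a^2 = 2 ((a + b) / 2) (b - a)]; the last coordinate
    enters linearly with slope 1. *)
Lemma svg_H_midpoint (R : realType) (L C : R) (x y : 'cV[R]_5) :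
  svg_H L C y - svg_H L C x = dotv (grad (svg_H L C) (midpoint x y)) (y - x).
Proof.
by rewrite grad_svg_H /dotv mxE big_ord5 /svg_H !mxE/=; field.
Qed.

(** In each column, [L^-1] times the current component [L * x_i] of the gradient cancels against
    [- x_i] times its last component 1. *)
Lemma svg_C_grad (R : realType) (L C : R) (x : 'cV[R]_5) :
  L != 0 -> (svg_C L x)^T *m grad (svg_H L C) x = 0.
Proof.
move=> L0; rewrite grad_svg_H; apply/matrixP => i j; rewrite (ord1 j) mxE big_ord5 !mxE.
by case: i => [[|[|//]] ?] /=; field.
Qed.

Lemma svg_C_continuous (R : realType) (L : R) : continuous (svg_C L).
Proof.
(* [svg_C] is affine in the state: only two entries of the last row vary, so continuity reduces to
   that of the coordinates. *)
have -> : svg_C L = fun x : 'cV[R]_5 =>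
    svg_C L 0 - x 0 0 *: delta_mx 4 0 - x 1 0 *: delta_mx 4 1.
  apply/funext => x; apply/matrixP => i j; rewrite !mxE; move: i.
  by case: j => [[|[|//]] ?]; apply: ord5_ind => /=; ring.
have coord i : continuous (fun x : 'cV[R]_5 => x i 0) by exact: coord_continuous.
by move=> x; exact: (cvgB (cvgB (cvg_cst _) (cvgZr_tmp (coord 0 x)))
  (cvgZr_tmp (coord 1 x))).
Qed.

Lemma approximates_cst (R : realType) n q (A : 'M[R]_(n, q)) :
  approximates (fun=> A) (fun _ _ => A).
Proof. by move=> x0; exact: cvg_cst. Qed.

(** The midpoint map is continuous and sends [(x0, x0)] to [x0], so composing with [M] gives the
    limit. *)
Lemma approximates_midpoint (R : realType) n q
    (M : 'cV[R]_n.+1 -> 'M[R]_(n.+1, q)) :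
  continuous M -> approximates M (fun x y => M (midpoint x y)).
Proof.
move=> Mcont x0.
have mid : (midpoint z.1 z.2 @[z --> (x0, x0)] --> midpoint x0 x0)%classic.
  apply: cvgZl_tmp; by apply: cvgD; [exact: (cvg_fst (F := nbhs x0))|
    exact: (cvg_snd (F := nbhs x0))].
have mid0 : midpoint x0 x0 = x0.
  by apply/matrixP => i j; rewrite !mxE; field.
rewrite mid0 in mid; apply: cvg_comp mid _; exact: Mcont.
Qed.

Lemma svg_midpoint_rule_balance (R : realType) (L C omega h : R)
    (d u : 'cV[R]_2) (x y : 'cV[R]_5) :
  L != 0 -> h != 0 -> svg_midpoint_rule L C omega h d u x y ->
  let g := grad (svg_H L C) (midpoint x y) in
  dotv g (svg_C L (midpoint x y) *m u) = 0 /\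
  dotv g (y - x) = h * dotv g (svg_B C *m d).
Proof.
move=> L0 h0 step g.
have gC : dotv g (svg_C L (midpoint x y) *m u) = 0.
  (* The row [g^T C] is the transpose of [C^T g], which vanishes at the midpoint. *)
  rewrite /dotv mulmxA -[g^T *m _]trmxK trmx_mul trmxK svg_C_grad// trmx0.
  by rewrite mul0mx mxE.
(* Writing [y - x] as [h *: (h^-1 *: (y - x))] exposes the left-hand side of the midpoint rule. *)
split=> //; rewrite -[y - x](scalerKV h0) step dotvZr !dotvDr gC.
by rewrite dotv_skew ?svg_J_skew// add0r addr0.
Qed.

Theorem mainTheorem3 (R : realType) (L C omega h : R)
    (L_gt0 : 0 < L) (C_gt0 : 0 < C) (omega_gt0 : 0 < omega) (h_gt0 : 0 < h) :
  let H := svg_H L C in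
  let gH := fun x y : 'cV[R]_5 => grad H (midpoint x y) in
  let B' := fun _ _ : 'cV[R]_5 => svg_B C in
  let C' := fun x y : 'cV[R]_5 => svg_C L (midpoint x y) in
  let step := svg_midpoint_rule L C omega h in
  [/\ dirac_structure_preserving (svg_system L C omega) h gH B' C' step,
      forall x y : 'cV[R]_5, H y - H x = dotv (gH x y) (y - x),
      forall (u d : 'cV[R]_2) (x y : 'cV[R]_5), step d u x y ->
        dotv (gH x y) (y - x) = h * dotv (gH x y) (svg_B C *m d),
      forall x y : 'cV[R]_5, (C' x y)^T *m gH x y = 0
    & forall (u : 'cV[R]_2) (x y : 'cV[R]_5), step 0 u x y -> H y = H x].
Proof.
move=> H gH B' C' step.
have L0 : L != 0 by rewrite gt_eqF.
have h0 : h != 0 by rewrite gt_eqF.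
have balance d u x y : step d u x y ->
    dotv (gH x y) (C' x y *m u) = 0 /\
    dotv (gH x y) (y - x) = h * dotv (gH x y) (svg_B C *m d).
  exact: svg_midpoint_rule_balance.
have gradC x y : (C' x y)^T *m gH x y = 0 by exact: svg_C_grad.
have gradH x y : H y - H x = dotv (gH x y) (y - x) by exact: svg_H_midpoint.
split=> //.
- split=> //.
  + exact: approximates_cst.
  + by apply: approximates_midpoint; exact: svg_C_continuous.
  + by move=> d u x y /balance[gC ->]; rewrite dotvDr gC add0r.
- by move=> u d x y /balance[].
- move=> u x y /balance[_ xy]; apply/eqP; rewrite -subr_eq0 gradH xy.
  by rewrite mulmx0 /dotv mulmx0 mxE mulr0.
Qed.
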